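(* Let $r\ge1$, let $q$ be a central invertible element (formal parameter), and let $(\mathbf R_{\alpha,n})_{0\le\alpha\le r+1,\,n\in\mathbb Z}$ be invertible elements of an algebra satisfying the $A_r$ quantum $Q$-system $$q^{\alpha(r+1-\alpha)}\,\mathbf R_{\alpha,n+1}\mathbf R_{\alpha,n-1}=(\mathbf R_{\alpha,n})^2+\mathbf R_{\alpha+1,n}\mathbf R_{\alpha-1,n}\quad(1\le\alpha\le r),\qquad \mathbf R_{0,n}=\mathbf R_{r+1,n}=\mathbf 1,$$ where variables belonging to a common initial data set satisfy, for $1\le\alpha<\beta\le r+1$, the $q$-commutation relations $\mathbf R_{\alpha,n}\mathbf R_{\beta,n+p}=q^{\alpha(r+1-\beta)p}\,\mathbf R_{\beta,n+p}\mathbf R_{\alpha,n}$. Let $\mathbf m=(m_1,\dots,m_r)$ be a Motzkin path ($m_{i+1}-m_i\in\{-1,0,1\}$) with initial data $\mathbf x_{\mathbf m}=\{\mathbf R_{\alpha,m_\alpha},\mathbf R_{\alpha,m_\alpha+1}\}_{\alpha=1}^r$. Then for every $n\ge0$, $\mathbf R_{1,n+m_1}\mathbf R_{1,m_1}^{-1}$ is a Laurent polynomial in the elements of $\mathbf x_{\mathbf m}$ with coefficients in $\mathbb Z_{\ge0}[q,q^{-1}]$ (i.e. a finite sum of products of elements of $\mathbf x_{\mathbf m}$ and their inverses, with coefficients in $\mathbb Z_{\ge0}[q,q^{-1}]$).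
   Formalization: The q-commutation relations are assumed for α ≤ β rather than α < β; the case α = β follows from the others when r ≥ 2, but for r = 1 it must be added, since otherwise R_{1,0}, R_{1,1} may be free and R_{1,4}R_{1,0}^{-1} is not a Laurent polynomial. *)

(* Defs.v *)
From HB Require Import structures.
From mathcomp Require Import all_boot all_order all_algebra.
Set Implicit Arguments. Unset Strict Implicit. Unset Printing Implicit Defensive.
Import Order.TTheory GRing.Theory Num.Theory.
Local Open Scope ring_scope.

(* A Motzkin path m = (m_1,...,m_r), encoded as a function nat -> int of
   which only the values at 1..r matter. *)
Definition motzkin (r : nat) (m : nat -> int) : Prop :=
  forall i : nat, (1 <= i)%N -> (i < r)%N ->
    `|m i.+1 - m i| <= 1.

Definition in_initial_data (A : unitRingType) (r : nat)
    (R : nat -> int -> A) (m : nat -> int) (y : A) : Prop :=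
  exists a : nat, [/\ (1 <= a)%N, (a <= r)%N &
    (y = R a (m a) \/ y = R a (m a + 1))].

Definition laurent_monomial (A : unitRingType) (q : A) (X : A -> Prop)
    (y : A) : Prop :=
  exists (k : int) (s : seq (A * bool)),
    (forall p, p \in s -> X p.1) /\
    y = q ^ k * \prod_(p <- s) (if p.2 then p.1 else p.1^-1).

(* Laurent polynomial in X with coefficients in Z_{>=0}[q,q^{-1}]:
   a finite sum (repetitions allowed, giving nonnegative integer
   coefficients) of such monomials. *)
Definition pos_laurent (A : unitRingType) (q : A) (X : A -> Prop)
    (y : A) : Prop :=
  exists s : seq A, (forall z, z \in s -> laurent_monomial q X z) /\
    y = \sum_(z <- s) z.

(* Main.v *)
(** The quantum Q-system is the compatibility condition of a linear problem: there
    are polynomials [D a n] in a central variable [t], with [D (r+2) n = 0] and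
    [D (r+1) n = 1], such that for every octahedron centred at [(a, n)] each triple
    among [D a n], [D a (n+1)], [D (a+1) n], [D (a+1) (n+1)] satisfies a three-term
    relation (L1-L4 below) with coefficients on the left.  Moreover [D 0 n] does not
    depend on [n] and has invertible constant term, so that
    [E a n = D a n * (D 0 0)^-1] is a power series in [t] satisfying the same
    relations, with [E 0 n = 1] and [E 1 n = \sum_j t^j R_{1,n+j}].
    Each relation involves the R-variables of one triangle only; the triangles cut
    out by a Motzkin path give, for each step 0, 1 or -1 of the path, two relations
    that determine the coefficients of the [E a n] near the path recursively, from
    monomials of the initial data and with plus signs only. *)

Require Import Defs.
From HB Require Import structures.
From mathcomp Require Import all_boot all_order all_algebra zify.
Import Order.TTheory GRing.Theory Num.Theory.
Local Open Scope ring_scope.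
Set Implicit Arguments.
Unset Strict Implicit.

(** * Elimination in three-term relations around one octahedron *)

Section OctahedronRelations.

Variables (A : unitRingType) (M : lmodType A).
Implicit Types (c x y : A) (u v w : M).

Let central c := forall x, c * x = x * c.

Lemma unit_scalerI c u v : c \is a GRing.unit -> c *: u = c *: v -> u = v.
Proof.
by move=> cU e; rewrite -[u]scale1r -[v]scale1r -(mulVr cU) -!scalerA e.
Qed.

Lemma central_swap c d x y : central c -> central d ->
  y * x = d * (x * y) -> y * (c * x) = c * x * (d * y).
Proof.
by move=> cC dC e; rewrite mulrA -cC -mulrA e -!mulrA (mulrA d) dC -mulrA.
Qed.

Lemma central_exchange c d x y : central c -> central d ->
  c * x * (d * y) = d * x * (c * y).
Proof.
move=> cC dC; rewrite -!mulrA (mulrA x) -dC -!mulrA (mulrA c) cC -!mulrA.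
by rewrite (mulrA c) (cC x) -mulrA.
Qed.

(* Around [(a, n)]: [Ap], [A0], [Am] stand for column [a] of [R] at times [n + 1],
   [n], [n - 1]; [B], [C0] for columns [a - 1], [a + 1] at time [n]; [X], [Y] for
   [D a n], [D a (n+1)]; [d1] for [D (a+1) n] and [V] for [t D (a+1) (n+1)]. *)
Variables (Q Q2 Ap A0 Am B C0 : A) (X Y d1 V : M).
Hypotheses (QC : central Q) (Q2C : central Q2).
Hypotheses (QU : Q \is a GRing.unit) (ApU : Ap \is a GRing.unit).
Hypothesis hQ : Q * Ap * Am = A0 * A0 + C0 * B.
Hypothesis A0Ap : A0 * Ap = Q * (Ap * A0).
Hypothesis L1 : C0 *: Y = (Q * Ap) *: d1 - A0 *: V.

(** After left multiplication by [C0], L1 eliminates [Y] and L4 eliminates [d1]; [hQ] rewrites the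
    coefficient [Q * Ap * Am] of [V], whose [A0 * A0] part cancels. *)
Lemma octahedron_L2 : C0 \is a GRing.unit ->
  A0 * C0 = C0 * A0 -> C0 * Ap = Q2 * (Ap * C0) ->
  (Q * A0) *: d1 = (Q2 * C0) *: X + Am *: V ->
  A0 *: Y = (Q * Ap) *: X + B *: V.
Proof.
move=> C0U A0C0 C0Ap L4; apply: (unit_scalerI C0U).
rewrite scalerA -A0C0 -scalerA L1 scalerBr !scalerA.
rewrite (central_swap QC QC A0Ap) -[(_ * _ * _) *: d1]scalerA L4 !scalerDr !scalerA.
rewrite (central_swap QC Q2C C0Ap) hQ scalerDl -addrA; congr (_ + _).
by rewrite addrAC subrr add0r.
Qed.

(** Multiplying by [Q * Ap] and applying [hQ] splits the left side into [A0] times L2 plus [B] times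
    L1, where the [V] terms cancel. *)
Lemma octahedron_L3 (Q' : A) : central Q' ->
  B * C0 = C0 * B -> A0 * B = B * A0 -> B * Ap = Q' * (Ap * B) ->
  A0 *: Y = (Q * Ap) *: X + B *: V ->
  Am *: Y = (Q * A0) *: X + (Q' * B) *: d1.
Proof.
move=> Q'C BC0 A0B BAp L2; apply: (@unit_scalerI (Q * Ap)); first by rewrite unitrMl.
rewrite scalerA hQ -BC0 scalerDl -!scalerA L1 L2.
rewrite scalerDr scalerBr !scalerDr !scalerA.
rewrite (central_swap QC QC A0Ap) (central_swap QC Q'C BAp) A0B.
rewrite !mulrA -addrA; congr (_ + _).
by rewrite addrCA subrr addr0.
Qed.

End OctahedronRelations.

(* Compatibility of the linear problem: [L2] and [L3] in column [a + 1],
   together with two instances of [L1], give [L4] in column [a].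
   Here [d0], [d1] are [D (a+1)] at times [n - 1], [n]; [d1t], [d2t] are [t D (a+1)]
   at times [n], [n + 1]; [gt] is [t D (a+2) n]; [Cm] is column [a + 1] at [n - 1]. *)
Lemma octahedron_L4 (A : unitRingType) (M : lmodType A)
    (Q Q1 Q2 Am A0 C0 Cm : A) (X d0 d1 d1t d2t gt : M) :
  (forall x, Q * x = x * Q) -> (forall x, Q1 * x = x * Q1) ->
  (forall x, Q2 * x = x * Q2) -> Cm \is a GRing.unit ->
  Am * A0 = Q * (A0 * Am) -> Cm * C0 = Q1 * (C0 * Cm) ->
  Cm * A0 = Q2 * (A0 * Cm) -> Am * C0 = Q2 * (C0 * Am) ->
  A0 * C0 = C0 * A0 -> Am * Cm = Cm * Am ->
  Cm *: X = (Q * A0) *: d0 - Am *: d1t ->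
  Cm *: d1 = (Q1 * C0) *: d0 + Am *: gt ->
  Cm *: d2t = (Q1 * C0) *: d1t + (Q2 * A0) *: gt ->
  (Q * A0) *: d1 = (Q2 * C0) *: X + Am *: d2t.
Proof.
move=> QC Q1C Q2C CmU AmA0 CmC0 CmA0 AmC0 A0C0 AmCm L1 L2 L3.
apply: (unit_scalerI CmU).
rewrite scalerDr !scalerA -AmCm (central_swap QC Q2C CmA0).
rewrite (central_swap Q2C Q1C CmC0) mulrA -[_ *: d1]scalerA -[_ *: d2t]scalerA L3.
have -> : Q2 * C0 * (Q1 * Cm) = Q2 * C0 * Q1 * Cm by rewrite !mulrA.
rewrite -[(_ * _ * Cm) *: X]scalerA L1 -scalerA L2.
rewrite scalerBr !scalerDr !scalerA.
rewrite (central_swap Q1C Q2C AmC0) (central_swap Q2C QC AmA0).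
rewrite scalerN scalerA -[Q * A0 * Q2 * Am]mulrA (central_exchange _ _ QC Q2C).
rewrite (central_exchange _ _ Q2C Q1C).
rewrite addrA addrNK; congr (_ *: _ + _).
rewrite -[LHS]mulrA -[RHS]mulrA (central_exchange _ _ QC Q2C).
have KC x : Q1 * Q * x = x * (Q1 * Q) by rewrite -mulrA QC mulrA Q1C -mulrA.
rewrite -!mulrA; congr (_ * _).
by rewrite (mulrA Q) -Q1C !(mulrA Q1) mulrA -KC -mulrA A0C0 mulrA KC -mulrA.
Qed.

Lemma poly_inv_mod (A : unitRingType) (p : {poly A}) N : p`_0 \is a GRing.unit ->
  exists w : {poly A}, forall j, (j <= N)%N -> (p * w)`_j = (j == 0)%:R.
Proof.
move=> pU; elim: N => [|N [w hw]].
  exists (p`_0)^-1%:P => j; rewrite leqn0 => /eqP ->.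
  by rewrite coefMC mulrV.
(* The correction cancels the coefficient of degree [N.+1] and leaves the lower ones unchanged. *)
exists (w + ((p`_0)^-1 * (- (p * w)`_N.+1))%:P * 'X^(N.+1)) => j.
rewrite mulrDr coefD mulrA coefMXn leq_eqVlt => /predU1P[->|hj].
  by rewrite ltnn subnn coefMC mulrA mulrV // mul1r subrr.
by rewrite hj addr0 hw.
Qed.

(** * Closure properties of positive Laurent polynomials *)

Section PositiveLaurent.

Variables (A : unitRingType) (q : A) (X : A -> Prop).
Hypotheses (qC : forall x : A, q * x = x * q) (qU : q \is a GRing.unit).
Local Notation pos := (pos_laurent q X).

Lemma laurent_monomialM x y :
  laurent_monomial q X x -> laurent_monomial q X y -> laurent_monomial q X (x * y).
Proof.
move=> [k [s [sX ->]]] [l [t [tX ->]]]; exists (k + l), (s ++ t); split.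
  by move=> p; rewrite mem_cat => /orP[/sX|/tX].
rewrite exprzDr // big_cat /= -!mulrA; congr (_ * _).
have ql z : z * q ^ l = q ^ l * z by apply: commrXz; rewrite /GRing.comm qC.
by rewrite mulrA ql -mulrA.
Qed.

Lemma pos_laurent_monomial x : laurent_monomial q X x -> pos x.
Proof.
by move=> hx; exists [:: x]; rewrite big_seq1; split=> // z; rewrite inE => /eqP ->.
Qed.

Lemma pos_laurent0 : pos 0.
Proof. by exists [::]; rewrite big_nil. Qed.

Lemma pos_laurentD x y : pos x -> pos y -> pos (x + y).
Proof.
move=> [s [hs ->]] [t [ht ->]]; exists (s ++ t); rewrite big_cat; split=> // z.
by rewrite mem_cat => /orP[/hs|/ht].
Qed.

Lemma pos_laurentM x y : pos x -> pos y -> pos (x * y).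
Proof.
move=> [s [hs ->]] [t [ht ->]]; exists [seq a * b | a <- s, b <- t]; split.
  by move=> z /allpairsP[[a b] [/hs ha /ht hb ->]]; exact: laurent_monomialM.
by rewrite big_allpairs_dep mulr_suml; apply: eq_bigr => i _; rewrite mulr_sumr.
Qed.

Lemma pos_laurent_qz (k : int) : pos (q ^ k).
Proof. by apply: pos_laurent_monomial; exists k, [::]; rewrite big_nil mulr1. Qed.

Lemma pos_laurent_q k : pos (q ^+ k).
Proof. exact: (pos_laurent_qz k). Qed.

Lemma pos_laurent_qV k : pos (q ^+ k)^-1.
Proof. by have := pos_laurent_qz (- k%:Z); rewrite -invr_expz. Qed.

Lemma pos_laurent1 : pos 1.
Proof. exact: (pos_laurent_q 0). Qed.

Lemma pos_laurent_gen x : X x -> pos x.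
Proof.
move=> Xx; apply: pos_laurent_monomial; exists 0, [:: (x, true)].
by rewrite expr0z mul1r big_seq1; split=> // p; rewrite inE => /eqP ->.
Qed.

Lemma pos_laurent_genV x : X x -> pos x^-1.
Proof.
move=> Xx; apply: pos_laurent_monomial; exists 0, [:: (x, false)].
by rewrite expr0z mul1r big_seq1; split=> // p; rewrite inE => /eqP ->.
Qed.

Lemma pos_laurent_solve u x y : u \is a GRing.unit -> pos u^-1 ->
  u * x = y -> pos y -> pos x.
Proof.
by move=> uU hu e hy; rewrite -(mulKr uU x) e; exact: pos_laurentM.
Qed.

End PositiveLaurent.

(* For [a <= b] this is the exponent [a * (r + 1 - b)] of the q-commutation
   relations, made symmetric in [a] and [b]. *)
Definition qcomm_exponent (r a b : nat) : nat := (minn a b * (r.+1 - maxn a b))%N.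

(** * The linear problem of the quantum Q-system *)

Section LaxPolynomials.

Variables (A : unitRingType) (r : nat) (q : A) (R : nat -> int -> A).
Hypothesis qC : forall x : A, q * x = x * q.
Hypothesis qU : q \is a GRing.unit.
Hypothesis R_unit : forall (a : nat) (n : int), (a <= r.+1)%N -> R a n \is a GRing.unit.
Hypothesis R0 : forall n : int, R 0%N n = 1.
Hypothesis Rr1 : forall n : int, R r.+1 n = 1.
Hypothesis Qsystem : forall (a : nat) (n : int), (1 <= a)%N -> (a <= r)%N ->
  q ^+ (a * (r.+1 - a)) * R a (n + 1) * R a (n - 1)
    = R a n ^+ 2 + R a.+1 n * R a.-1 n.
Hypothesis comm_data : forall m : nat -> int, motzkin r m ->
  forall (a b : nat) (e f : bool), (1 <= a)%N -> (a <= b)%N -> (b <= r)%N ->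
    let x := R a (m a + e%:Z) in
    let y := R b (m b + f%:Z) in
    x * y = q ^ ((a * (r.+1 - b))%:Z * ((m b + f%:Z) - (m a + e%:Z))) * y * x.

Local Notation lam := (qcomm_exponent r).

Lemma q_exp_central k x : q ^+ k * x = x * q ^+ k.
Proof. by apply/commr_sym/commrX; rewrite /GRing.comm qC. Qed.

Lemma qcomm_exponentC a b : lam a b = lam b a.
Proof. by rewrite /qcomm_exponent minnC maxnC. Qed.

Lemma flat_motzkin (n : int) : motzkin r (fun=> n).
Proof. by move=> i _ _; rewrite subrr normr0. Qed.

Lemma qcomm_same_time a b n : (a <= r.+1)%N -> (b <= r.+1)%N ->
  R a n * R b n = R b n * R a n.
Proof.
wlog leab : a b / (a <= b)%N => [H|].
  by case: (leqP a b) => [/H//|/ltnW/H{}H] ? ?; rewrite H.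
case: a leab => [|a] leab ha; first by rewrite R0 mul1r mulr1.
rewrite leq_eqVlt => /predU1P[->|hb]; first by rewrite Rr1 mul1r mulr1.
have /= := comm_data (@flat_motzkin n) (a:=a.+1) false false isT leab hb.
by rewrite addr0 subrr mulr0 expr0z mul1r.
Qed.

Lemma qcomm_next_time a b n : (a <= r.+1)%N -> (b <= r.+1)%N ->
  R a n * R b (n + 1) = q ^+ lam a b * (R b (n + 1) * R a n).
Proof.
case: a => [|a] ha; first by rewrite R0 /qcomm_exponent min0n expr0 !mul1r mulr1.
case: b => [|b] hb; first by rewrite R0 /qcomm_exponent minn0 expr0 !mul1r mulr1.
move: ha; rewrite leq_eqVlt => /predU1P[->|ha].
  by rewrite Rr1 /qcomm_exponent (maxn_idPl hb) subnn muln0 expr0 !mul1r mulr1.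
move: hb; rewrite leq_eqVlt => /predU1P[->|hb].
  rewrite Rr1 /qcomm_exponent (maxn_idPr _) ?subnn ?muln0 ?expr0 ?mul1r ?mulr1 //.
  exact: ltnW.
case: (leqP a.+1 b.+1) => hab.
  have /= := comm_data (@flat_motzkin n) (a:=a.+1) false true isT hab hb.
  rewrite addr0 (addrC n) addrK mulr1 mulrA /qcomm_exponent.
  by rewrite (minn_idPl hab) (maxn_idPr hab).
(* Here the smaller index carries the later time, so the power of [q] comes out inverted. *)
have /= := comm_data (@flat_motzkin n) (a:=b.+1) true false isT (ltnW hab) ha.
rewrite addr0 opprD addrA subrr add0r mulrN1 -invr_expz.
rewrite /qcomm_exponent (minn_idPr (ltnW hab)) (maxn_idPl (ltnW hab)) => ->.
rewrite -!mulrA mulrA mulrV ?mul1r //.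
by rewrite unitrX.
Qed.

(* Column [a - 1]; column [-1] is set to 0, so that the Q-system also holds for
   the constant column 0. *)
Definition Rprev (a : nat) (n : int) : A := if a is b.+1 then R b n else 0.

Lemma Qsystem0 a n : (a <= r)%N ->
  q ^+ lam a a * R a (n + 1) * R a (n - 1) = R a n * R a n + R a.+1 n * Rprev a n.
Proof.
case: a => [_|a ha]; first by rewrite !R0 /= /qcomm_exponent min0n expr0 !mulr1 mulr0 addr0.
by rewrite -expr2 -(Qsystem n (isT : (1 <= a.+1)%N) ha) /qcomm_exponent minnn maxnn.
Qed.

(* [lax_rev k] is column [r.+2 - k]: the recursion solves [lax_L1] below
   for the left column, starting from the right boundary. *)
Fixpoint lax_rev (k : nat) (n : int) : {poly A} :=
  match k with
  | 0 => 0
  | k1.+1 => match k1 with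
    | 0 => 1
    | k2.+1 => let a := (r - k2)%N in
        (R a.+1 (n - 1))^-1 *:
          ((q ^+ lam a a * R a n) *: lax_rev k1 (n - 1)
           - R a (n - 1) *: (lax_rev k1 n * 'X))
    end
  end.

Lemma lax_revSS k n : lax_rev k.+2 n = (R (r - k).+1 (n - 1))^-1 *:
  ((q ^+ lam (r - k) (r - k) * R (r - k) n) *: lax_rev k.+1 (n - 1)
   - R (r - k) (n - 1) *: (lax_rev k.+1 n * 'X)).
Proof. by []. Qed.

Definition lax (a : nat) (n : int) : {poly A} := lax_rev (r.+2 - a) n.

Lemma lax_last n : lax r.+2 n = 0.
Proof. by rewrite /lax subnn. Qed.

Lemma lax_boundary n : lax r.+1 n = 1.
Proof. by rewrite /lax subSnn. Qed.

Lemma lax_L1 a n : (a <= r)%N ->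
  R a.+1 n *: lax a (n + 1) =
    (q ^+ lam a a * R a (n + 1)) *: lax a.+1 n - R a n *: (lax a.+1 (n + 1) * 'X).
Proof.
move=> ha; rewrite /lax; have -> : (r.+2 - a = (r - a).+2)%N by lia.
have -> : (r.+2 - a.+1 = (r - a).+1)%N by lia.
rewrite lax_revSS subKn // addrK scalerA mulrV ?scale1r //.
exact: R_unit.
Qed.

Let rel2 a := forall n,
  R a n *: lax a (n + 1) =
    (q ^+ lam a a * R a (n + 1)) *: lax a n + Rprev a n *: (lax a.+1 (n + 1) * 'X).
Let rel3 a := forall n,
  R a (n - 1) *: lax a (n + 1) =
    (q ^+ lam a a * R a n) *: lax a n + (q ^+ lam a.-1 a * Rprev a n) *: lax a.+1 n.
Let rel4 a := forall n,
  (q ^+ lam a a * R a n) *: lax a.+1 n =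
    (q ^+ lam a a.+1 * R a.+1 n) *: lax a n + R a (n - 1) *: (lax a.+1 (n + 1) * 'X).

Lemma rel4_of_next a : (a <= r)%N -> rel2 a.+1 -> rel3 a.+1 -> rel4 a.
Proof.
move=> ha h2 h3 n.
have ha1 : (a <= r.+1)%N by exact: leqW.
have step b c : (b <= r.+1)%N -> (c <= r.+1)%N ->
    R b (n - 1) * R c n = q ^+ lam b c * (R c n * R b (n - 1)).
  by move=> hb hc; have := qcomm_next_time (n - 1) hb hc; rewrite subrK.
have e1 := lax_L1 (n - 1) ha; rewrite subrK in e1.
have e2 := h2 (n - 1); rewrite subrK in e2.
have e3 := congr1 (fun p => p * 'X) (h3 n).
rewrite mulrDl -!scalerAl /= in e3.
apply: (octahedron_L4 (q_exp_central _) (q_exp_central _) (q_exp_central _)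
          _ _ _ _ _ _ _ e1 e2 e3).
- exact: R_unit.
- exact: step.
- exact: step.
- by rewrite qcomm_exponentC; exact: step.
- exact: step.
- exact: qcomm_same_time.
- exact: qcomm_same_time.
Qed.

Lemma rel2_of_rel4 a : (a <= r)%N -> rel4 a -> rel2 a.
Proof.
move=> ha h4 n.
have ha1 : (a <= r.+1)%N by exact: leqW.
apply: (octahedron_L2 (q_exp_central _) (q_exp_central _)
          (Qsystem0 n ha) _ (lax_L1 n ha) _ _ _ (h4 n)).
- exact: qcomm_next_time.
- exact: R_unit.
- exact: qcomm_same_time.
- by rewrite qcomm_exponentC; exact: qcomm_next_time.
Qed.

Lemma rel3_of_rel2 a : (1 <= a)%N -> (a <= r)%N -> rel2 a -> rel3 a.
Proof.
case: a => // a _ ha h2 n.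
have [ha1 ha2] : (a <= r.+1)%N /\ (a.+1 <= r.+1)%N by lia.
apply: (octahedron_L3 (q_exp_central _) _ _
          (Qsystem0 n ha) _ (lax_L1 n ha) (q_exp_central _) _ _ _ (h2 n)).
- by rewrite unitrX.
- exact: R_unit.
- exact: qcomm_next_time.
- exact: qcomm_same_time.
- exact: qcomm_same_time.
- exact: qcomm_next_time.
Qed.

(** Descending induction from the constant column [r.+1]: L2 and L3 in one column give L4 in the
    column to its left, hence L2 and then L3 there. *)
Lemma lax_rel23 a : (a <= r.+1)%N -> rel2 a /\ ((1 <= a)%N -> rel3 a).
Proof.
move=> /subKn <-; elim: (r.+1 - a)%N => [|k [IH2 IH3]].
  have lam0 : lam r.+1 r.+1 = 0%N by rewrite /qcomm_exponent maxnn subnn muln0.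
  rewrite subn0; split=> [|_] n; rewrite !lax_boundary !lax_last lam0 !Rr1 expr0 mulr1.
    by rewrite mul0r scaler0 addr0.
  by rewrite scaler0 addr0.
(* For [k > r] both truncated subtractions are 0 and the induction hypothesis is the goal. *)
have [hk|hk] := leqP k r; last first.
  by move: IH2 IH3; have -> : (r.+1 - k.+1 = r.+1 - k)%N by lia.
have ha : (r.+1 - k.+1 <= r)%N by lia.
have e : (r.+1 - k = (r.+1 - k.+1).+1)%N by lia.
rewrite e in IH2 IH3.
have h2 := rel2_of_rel4 ha (rel4_of_next ha IH2 (IH3 isT)).
by split=> // h1; exact: rel3_of_rel2.
Qed.

Lemma lax_L2 a n : (a <= r.+1)%N ->
  R a n *: lax a (n + 1) =
    (q ^+ lam a a * R a (n + 1)) *: lax a n + Rprev a n *: (lax a.+1 (n + 1) * 'X).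
Proof. by move=> ha; have [h _] := lax_rel23 ha; exact: h. Qed.

Lemma lax_L3 a n : (a <= r)%N ->
  R a.+1 (n - 1) *: lax a.+1 (n + 1) =
    (q ^+ lam a.+1 a.+1 * R a.+1 n) *: lax a.+1 n
    + (q ^+ lam a a.+1 * R a n) *: lax a.+2 n.
Proof. by move=> ha; have [_ h] := @lax_rel23 a.+1 ha; exact: h. Qed.

Lemma lax_L4 a n : (a <= r)%N ->
  (q ^+ lam a a * R a n) *: lax a.+1 n =
    (q ^+ lam a a.+1 * R a.+1 n) *: lax a n + R a (n - 1) *: (lax a.+1 (n + 1) * 'X).
Proof.
move=> ha; have [h2 h3] := @lax_rel23 a.+1 ha.
by move: n; apply: rel4_of_next => //; exact: h3.
Qed.

(** In column 0 the shifted term of L2 has coefficient [Rprev 0 n = 0] and the other coefficients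
    are 1. *)
Lemma lax0_const n : lax 0 n = lax 0 0.
Proof.
have step k : lax 0 (k + 1) = lax 0 k.
  have := @lax_L2 0 k isT; rewrite !R0 scale1r /= scale0r addr0.
  by rewrite /qcomm_exponent min0n expr0 mulr1 scale1r.
case: n => k; first by elim: k => // k <-; rewrite -(step k); congr lax; lia.
elim: k => [|k <-]; first by rewrite -(step (Negz 0)).
by rewrite -(step (Negz k.+1)); congr lax; lia.
Qed.

(** The ['X] term of L1 has no constant coefficient, so constant terms of adjacent columns differ by
    unit factors. *)
Lemma lax_coef0_unit a n : (a <= r.+1)%N -> (lax a n)`_0 \is a GRing.unit.
Proof.
move=> ha; move: n; rewrite -(subKn ha); elim: (r.+1 - a)%N => [|k IH] n.
  by rewrite subn0 lax_boundary coef1 unitr1.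
have [hk|hk] := leqP k r; last by have -> : (r.+1 - k.+1 = r.+1 - k)%N by lia.
have ha' : (r.+1 - k.+1 <= r)%N by lia.
have e : (r.+1 - k = (r.+1 - k.+1).+1)%N by lia.
rewrite e in IH; set b := (r.+1 - k.+1)%N in ha' IH *.
have := congr1 (fun p : {poly A} => p`_0) (lax_L1 (n - 1) ha').
rewrite subrK coefB !coefZ coefMX mulr0 subr0 => h.
have RU := R_unit (n - 1) (ha' : (b.+1 <= r.+1)%N).
rewrite -(unitrMr _ RU) h unitrMl ?IH // unitrMl ?unitrX //.
by apply: R_unit; exact: leqW.
Qed.

(** * Positivity along a Motzkin path *)

Section Positivity.

Variable m : nat -> int.
Hypotheses (r_gt0 : (1 <= r)%N) (m_motzkin : motzkin r m).
Local Notation pos := (pos_laurent q (in_initial_data r R m)).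

(* The boundary columns 0 and [r.+1] are constant, so the path may be continued
   horizontally into them. *)
Definition extended_path (a : nat) : int :=
  if a == 0%N then m 1%N else if a == r.+1 then m r else m a.
Local Notation mu := extended_path.

Lemma extended_path_step a : (a <= r)%N ->
  [\/ mu a.+1 = mu a - 1, mu a.+1 = mu a | mu a.+1 = mu a + 1].
Proof.
rewrite /extended_path !eqSS; case: a => [|a] ha /=.
  by rewrite (ltn_eqF r_gt0); constructor 2.
rewrite eqSS (ltn_eqF ha); move: ha; rewrite leq_eqVlt.
case: eqP => [->|_ /= ha]; first by constructor 2.
have := m_motzkin (isT : (1 <= a.+1)%N) ha; move: (m a.+1) (m a.+2) => x y hxy.
have [->|[->|->]] : y = x - 1 \/ y = x \/ y = x + 1 by lia.
- by constructor 1.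
- by constructor 2.
- by constructor 3.
Qed.

Lemma pos_data a n : (a <= r.+1)%N -> n = mu a \/ n = mu a + 1 ->
  pos (R a n) /\ pos (R a n)^-1.
Proof.
rewrite /extended_path; case: a => [|a] ha hn.
  by rewrite R0 invr1; split; exact: pos_laurent1.
move: ha hn; rewrite leq_eqVlt !eqSS /=; case: eqP => [->|_ /= ha] hn.
  by rewrite Rr1 invr1; split; exact: pos_laurent1.
have hX : in_initial_data r R m (R a.+1 n).
  by exists a.+1; split=> //; case: hn => ->; [left|right].
by split; [exact: pos_laurent_gen|exact: pos_laurent_genV].
Qed.

Lemma pos_qdata k a n : (a <= r.+1)%N -> n = mu a \/ n = mu a + 1 ->
  pos (q ^+ k * R a n) /\ pos (q ^+ k * R a n)^-1.
Proof.
move=> ha /(pos_data ha)[h hV]; split.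
  by apply: pos_laurentM => //; exact: pos_laurent_q.
rewrite invrM ?unitrX ?R_unit //.
by apply: pos_laurentM => //; exact: pos_laurent_qV.
Qed.

(* [w] inverts [lax 0 0] modulo ['X^N.+1], which avoids power series; [e a n j] is
   the coefficient of [t^j] in the series [E a n] of the header. *)
Section Truncation.

Variables (N : nat) (w : {poly A}).
Hypothesis w_inv : forall j, (j <= N)%N -> (lax 0 0 * w)`_j = (j == 0)%:R.

Let e a n j := (lax a n * w)`_j.
Let te a n j := if j is i.+1 then e a n i else 0.

Lemma coef_shift a n j : (lax a n * 'X * w)`_j = te a n j.
Proof. by rewrite -mulrA -commr_polyX mulrA coefMX; case: j. Qed.

Lemma e_last n j : e r.+2 n j = 0.
Proof. by rewrite /e lax_last mul0r coef0. Qed.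

Lemma te_last n j : te r.+2 n j = 0.
Proof. by case: j => //= j; exact: e_last. Qed.

Lemma e_zero n j : (j <= N)%N -> e 0 n j = (j == 0)%:R.
Proof. by rewrite /e lax0_const; exact: w_inv. Qed.

Lemma e_L1 a n j : (a <= r)%N ->
  q ^+ lam a a * R a (n + 1) * e a.+1 n j =
    R a.+1 n * e a (n + 1) j + R a n * te a.+1 (n + 1) j.
Proof.
move=> ha; have := congr1 (fun p : {poly A} => (p * w)`_j) (lax_L1 n ha).
by rewrite mulrBl -!scalerAl coefB !coefZ coef_shift => ->; rewrite subrK.
Qed.

Lemma e_L2 a n j : (a <= r.+1)%N ->
  R a n * e a (n + 1) j =
    q ^+ lam a a * R a (n + 1) * e a n j + Rprev a n * te a.+1 (n + 1) j.
Proof.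
move=> ha; have := congr1 (fun p : {poly A} => (p * w)`_j) (lax_L2 n ha).
by rewrite mulrDl -!scalerAl coefD !coefZ coef_shift.
Qed.

Lemma e_L3 a n j : (a <= r)%N ->
  R a.+1 (n - 1) * e a.+1 (n + 1) j =
    q ^+ lam a.+1 a.+1 * R a.+1 n * e a.+1 n j
    + q ^+ lam a a.+1 * R a n * e a.+2 n j.
Proof.
move=> ha; have := congr1 (fun p : {poly A} => (p * w)`_j) (lax_L3 n ha).
by rewrite mulrDl -!scalerAl coefD !coefZ.
Qed.

Lemma e_L4 a n j : (a <= r)%N ->
  q ^+ lam a a * R a n * e a.+1 n j =
    q ^+ lam a a.+1 * R a.+1 n * e a n j + R a (n - 1) * te a.+1 (n + 1) j.
Proof.
move=> ha; have := congr1 (fun p : {poly A} => (p * w)`_j) (lax_L4 n ha).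
by rewrite mulrDl -!scalerAl coefD !coefZ coef_shift.
Qed.

(** With [E 0 = 1], L1 in column 0 reads [E 1 n = R 1 n + t E 1 (n + 1)]. *)
Lemma e_first n j : (j <= N)%N -> e 1 n j = R 1 (n + j%:Z).
Proof.
elim: j n => [|j IH] n hj; have := @e_L1 0 n _ (leq0n r).
  move=> /(_ 0); rewrite !R0 /qcomm_exponent min0n expr0 !mul1r e_zero //=.
  by rewrite mulr1 !addr0.
move=> /(_ j.+1); rewrite !R0 /qcomm_exponent min0n expr0 !mul1r e_zero //=.
by rewrite mulr0 add0r IH ?(ltnW hj) // => ->; congr (R 1 _); lia.
Qed.

(** * Propagation of positivity along the path in a fixed degree *)

Section Step.

Variable j : nat.
Hypothesis j_le : (j <= N)%N.
Hypothesis te_pos : forall a, (a <= r)%N ->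
  pos (te a.+1 (mu a.+1 + 1) j) /\ pos (te a.+1 (mu a + 1) j).

Lemma te_next_pos a : (a <= r)%N -> pos (te a.+2 (mu a.+1 + 1) j).
Proof.
rewrite leq_eqVlt => /predU1P[->|/te_pos[]//].
by rewrite te_last; exact: pos_laurent0.
Qed.

(** The condition on [n] excludes a step -1, so that [R a n], the coefficient of the shifted term in
    L2, is initial data. *)
Lemma e_top_pos a n : (a <= r)%N -> n = mu a.+1 -> n = mu a \/ n = mu a + 1 ->
  pos (e a.+1 n j) -> pos (e a.+1 (n + 1) j).
Proof.
move=> ha hn hn' he; have ha2 : (a.+1 <= r.+1)%N := ha.
have [_ hV] := pos_data ha2 (or_introl hn).
apply: (pos_laurent_solve qC qU _ hV (e_L2 n j ha2)); first exact: R_unit.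
apply: pos_laurentD; apply: pos_laurentM => //.
- by apply: (proj1 (pos_qdata _ _ _)) => //; right; rewrite hn.
- by apply: (proj1 (pos_data _ _)) => //; exact: leqW.
- by rewrite hn; exact: te_next_pos.
Qed.

(* Steps -1 and 0 of the path use L1, step 1 uses L4; L2 then reaches
   [mu a.+1 + 1] for the steps 0 and 1. *)
Lemma e_up_pos a : (a <= r)%N -> pos (e a (mu a + 1) j) ->
  pos (e a.+1 (mu a.+1 + 1) j) /\
  (mu a.+1 <> mu a - 1 -> pos (e a.+1 (mu a + 1) j)).
Proof.
move=> ha hW; have [t1 t2] := te_pos ha.
have ha1 := leqW ha; have ha2 : (a.+1 <= r.+1)%N := ha.
have bottom : mu a = mu a.+1 \/ mu a = mu a.+1 + 1 -> pos (e a.+1 (mu a) j).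
  move=> hmu; have [_ hV] := pos_qdata (lam a a) ha1 (or_intror (erefl (mu a + 1))).
  apply: (pos_laurent_solve qC qU _ hV (e_L1 (mu a) j ha)).
    by rewrite unitrMl ?unitrX ?R_unit.
  apply: pos_laurentD; apply: pos_laurentM => //.
    by case: (pos_data ha2 hmu).
  by case: (pos_data ha1 (or_introl (erefl (mu a)))).
case: (extended_path_step ha) => hs.
- split=> [|/(_ hs)//]; have e1 : mu a.+1 + 1 = mu a by rewrite hs subrK.
  by rewrite e1; apply: bottom; right.
- have h := @e_top_pos a (mu a) ha (esym hs) (or_introl erefl) (bottom (or_introl (esym hs))).
  by rewrite hs.
have h1 : pos (e a.+1 (mu a + 1) j).
  have [_ hV] := pos_qdata (lam a a) ha1 (or_intror (erefl (mu a + 1))).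
  apply: (pos_laurent_solve qC qU _ hV (e_L4 (mu a + 1) j ha)).
    by rewrite unitrMl ?unitrX ?R_unit.
  apply: pos_laurentD; apply: pos_laurentM => //.
  + by apply: (proj1 (pos_qdata _ _ _)) => //; left.
  + by rewrite addrK; case: (pos_data ha1 (or_introl (erefl (mu a)))).
  + by rewrite -hs.
split=> //; rewrite hs; apply: e_top_pos => //; by right.
Qed.

Lemma e_W_pos a : (a <= r.+1)%N -> pos (e a (mu a + 1) j).
Proof.
elim: a => [_|a IH ha]; last by case: (e_up_pos ha (IH (ltnW ha))).
by rewrite e_zero //; case: eqP => _; [exact: pos_laurent1|exact: pos_laurent0].
Qed.

(* For a step -1 the relation L3 has no factor [t], so it refers to the next column
   in the same degree: hence the induction from the right boundary. *)
Lemma e_Z_pos a : (a <= r)%N -> pos (e a.+1 (mu a + 1) j).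
Proof.
move=> ha; have [k] := ubnP (r - a)%N; elim: k a ha => // k IH a ha hk.
have [_ hZ] := e_up_pos ha (e_W_pos (leqW ha)).
case: (extended_path_step ha) => hs; try by apply: hZ; lia.
have hW := e_W_pos (ha : (a.+1 <= r.+1)%N).
have e1 : mu a = mu a.+1 + 1 by rewrite hs subrK.
(* The left coefficient of L3 at time [mu a] is [R a.+1 (mu a.+1)], which is initial data. *)
have [_ hV] := pos_data (ha : (a.+1 <= r.+1)%N) (or_introl (esym hs)).
apply: (pos_laurent_solve qC qU _ hV (e_L3 (mu a) j ha)); first exact: R_unit.
apply: pos_laurentD; apply: pos_laurentM => //.
- by apply: (proj1 (pos_qdata _ _ _)) => //; right.
- by rewrite e1.
- by apply: (proj1 (pos_qdata _ _ _)); [exact: leqW|left].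
move: (ha); rewrite leq_eqVlt => /predU1P[->|ha'].
  by rewrite e_last; exact: pos_laurent0.
by rewrite e1; apply: IH => //; lia.
Qed.

End Step.

(** [te] vanishes in degree 0 and in degree [j.+1] is [e] in degree [j], so induction on [j]
    supplies [te_pos]. *)
Lemma e_pos j : (j <= N)%N -> forall a, (a <= r)%N ->
  pos (e a.+1 (mu a.+1 + 1) j) /\ pos (e a.+1 (mu a + 1) j).
Proof.
elim: j => [|j IH] hj a ha; split.
- by apply: e_W_pos => // b hb; split; exact: pos_laurent0.
- by apply: e_Z_pos => // b hb; split; exact: pos_laurent0.
- by apply: e_W_pos => // b hb; apply: IH => //; exact: ltnW.
- by apply: e_Z_pos => // b hb; apply: IH => //; exact: ltnW.
Qed.

End Truncation.

Lemma pos_laurent_R1 n : pos (R 1 (m 1%N + 1 + n%:Z)).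
Proof.
have [w hw] := poly_inv_mod n (lax_coef0_unit 0 (leq0n r.+1)).
(* The second component at [a = 0] concerns column 1 at time [mu 0 + 1], and [mu 0] is [m 1]. *)
have [_] := e_pos hw (leqnn n) (leq0n r).
by rewrite (e_first hw).
Qed.

End Positivity.

End LaxPolynomials.

Unset Implicit Arguments.

Theorem mainTheorem15 (A : unitRingType) (r : nat) (q : A)
  (R : nat -> int -> A)
  (hr : (1 <= r)%N)
  (hq_central : forall x : A, q * x = x * q)
  (hq_unit : q \is a GRing.unit)
  (hR_unit : forall (a : nat) (n : int), (a <= r.+1)%N -> R a n \is a GRing.unit)
  (hR0 : forall n : int, R 0%N n = 1)
  (hRr1 : forall n : int, R r.+1 n = 1)
  (hQ : forall (a : nat) (n : int), (1 <= a)%N -> (a <= r)%N ->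
     q ^+ (a * (r.+1 - a)) * R a (n + 1) * R a (n - 1)
       = R a n ^+ 2 + R a.+1 n * R a.-1 n)
  (hcomm : forall (m : nat -> int), motzkin r m ->
     forall (a b : nat) (e f : bool), (1 <= a)%N -> (a <= b)%N -> (b <= r)%N ->
       let x := R a (m a + e%:Z) in
       let y := R b (m b + f%:Z) in
       x * y = q ^ ((a * (r.+1 - b))%:Z * ((m b + f%:Z) - (m a + e%:Z))) * y * x)
  (m : nat -> int) (hm : motzkin r m) :
  forall n : nat,
    pos_laurent q (in_initial_data r R m)
      (R 1%N (n%:Z + m 1%N) * (R 1%N (m 1%N))^-1).

Proof.
(* [pos_laurent_R1] starts at time [m 1 + 1]; at time [m 1] the quotient is 1. *)
case=> [|n]; first by rewrite add0r mulrV ?hR_unit //; exact: pos_laurent1.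
apply: pos_laurentM => //.
  have -> : n.+1%:Z + m 1%N = m 1%N + 1 + n%:Z by lia.
  exact: (pos_laurent_R1 hq_central hq_unit hR_unit hR0 hRr1 hQ hcomm hr hm).
by apply: pos_laurent_genV; exists 1%N; split=> //; left.
Qed.
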